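(* The unital formal multiplication $F$ on $k^2$ given by the power series $$F\big((x_2,x_3),(y_2,y_3)\big)=\frac{1}{1+x_2y_3+x_3y_2}\,(x_2+y_2,\;x_3+y_3)$$ is not linear.
   Context: $k$ is a field of characteristic $0$. For $V=k^n$ with basis $e_1,\dots,e_n$ and coordinates $x_1,\dots,x_n$, a unital formal multiplication (a linear map $F\colon k[V]\otimes k[V]\to V$ with $F(\mu\otimes1)=\pi_V(\mu)=F(1\otimes\mu)$, where $k[V]$ is the symmetric coalgebra with elements of $V$ primitive) is identified with an $n$-tuple of formal power series $F(x,y)$ with $F(x,0)=x$, $F(0,y)=y$, by letting $F(e^{a}\otimes e^{b})$ be $\partial_x^{a}\partial_y^{b}F|_{(0,0)}$ for monomials $e^a=e_1^{a_1}\cdots e_n^{a_n}$. For a formal map $\theta\colon k[V]\to W$, $\theta'(\mu)=\sum_{n\ge0}\frac1{n!}\theta(\mu_{(1)})\cdots\theta(\mu_{(n)})$; $k[F]$ is $k[V]$ with product $F'$. A homomorphism $\psi\colon F\to H$ is a formal map with $H(\psi'(\mu_1)\otimes\psi'(\mu_2))=\psi(F'(\mu_1\otimes\mu_2))$. $F$ is linear if there exist a finite-dimensional vector space $A$ with bilinear product $*$ and a homomorphism $\psi\colon F\to G$, with $G(\mathbf x,\mathbf y)=\mathbf x+\mathbf y+\mathbf x*\mathbf y$ (i.e. $G(\mu_1\otimes\mu_2)=\epsilon(\mu_2)\pi_A(\mu_1)+\epsilon(\mu_1)\pi_A(\mu_2)+\pi_A(\mu_1)*\pi_A(\mu_2)$),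 such that $g\mapsto g\circ\psi'$, $k[A]^*\to k[V]^*$, is surjective. *)

(* Defs.v *)
From HB Require Import structures.
From mathcomp Require Import all_boot all_order all_algebra.
Set Implicit Arguments. Unset Strict Implicit. Unset Printing Implicit Defensive.
Import GRing.Theory.
Local Open Scope ring_scope.

Section PowerSeries.
Variable k : fieldType.

Definition mi (I : finType) := {ffun I -> nat}.
Definition ps (I : finType) := mi I -> k.
Definition mdeg (I : finType) (a : mi I) : nat := (\sum_(i : I) a i)%N.

Definition ps0 (I : finType) : ps I := fun _ => 0.
Definition ps1 (I : finType) : ps I :=
  fun a => if [forall i, a i == 0%N] then 1 else 0.
Definition psX (I : finType) (i : I) : ps I :=
  fun a => if [forall j, a j == nat_of_bool (j == i)] then 1 else 0.
Definition psadd (I : finType) (f g : ps I) : ps I := fun a => f a + g a.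
Definition psopp (I : finType) (f : ps I) : ps I := fun a => - f a.
Definition psscale (I : finType) (c : k) (f : ps I) : ps I := fun a => c * f a.

Definition psmul (I : finType) (f g : ps I) : ps I :=
  fun a => \sum_(b : {ffun I -> 'I_(mdeg a).+1} | [forall i, (val (b i) <= a i)%N])
             f [ffun i => val (b i)] * g [ffun i => (a i - val (b i))%N].

Definition psexp (I : finType) (f : ps I) (t : nat) : ps I := iter t (psmul f) (@ps1 I).

Definition pssum (I J : finType) (F : J -> ps I) : ps I := \big[@psadd I/@ps0 I]_(j : J) F j.
Definition psprod (I J : finType) (F : J -> ps I) : ps I := \big[@psmul I/@ps1 I]_(j : J) F j.

(* substitution g(phi(x)) of power series phi_j without constant term
   into g; only monomials of degree <= deg a contribute to the a-coefficient *)
Definition pscomp (I J : finType) (g : ps J) (phi : J -> ps I) : ps I :=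
  fun a => \sum_(b : {ffun J -> 'I_(mdeg a).+1})
             g [ffun j => val (b j)] * psprod (fun j => psexp (phi j) (val (b j))) a.

(* 1/(1+u) = sum_t (-u)^t for u without constant term *)
Definition psgeom (I : finType) (u : ps I) : ps I :=
  fun a => \sum_(t < (mdeg a).+1) psexp (psopp u) t a.

(* A formal map theta : k[V] -> W, identified (as in the paper) with a
   W-tuple of power series without constant term. *)
Definition formal_map (I J : finType) (psi : J -> ps I) : Prop :=
  forall j, psi j [ffun _ => 0%N] = 0.

Definition psx (I : finType) (i : I) : ps (I + I)%type := psX (inl i).
Definition psy (I : finType) (i : I) : ps (I + I)%type := psX (inr i).

Definition is_hom (I J : finType) (F : I -> ps (I + I)%type)
    (H : J -> ps (J + J)%type) (psi : J -> ps I) : Prop :=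
  formal_map psi /\
  forall l : J,
    pscomp (H l) (fun v => match v with
                           | inl j => pscomp (psi j) (@psx I)
                           | inr j => pscomp (psi j) (@psy I)
                           end)
    = pscomp (psi l) F.

(* G(x,y) = x + y + x*y on A = k^m, with bilinear product given by
   structure constants: e_i * e_j = sum_l c i j l e_l *)
Definition Gmul (m : nat) (c : 'I_m -> 'I_m -> 'I_m -> k) : 'I_m -> ps ('I_m + 'I_m)%type :=
  fun l => psadd (psadd (psx l) (psy l))
                 (pssum (fun i => pssum (fun j => psscale (c i j l) (psmul (psx i) (psy j))))).

(* F is linear: there is a finite-dimensional algebra A = k^m (any bilinear
   product) and a homomorphism psi : F -> G such that g |-> g o psi'
   (i.e. composition of power series, k[A]^* = k[[A]]) is surjective *)
Definition is_linear (I : finType) (F : I -> ps (I + I)%type) : Prop :=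
  exists (m : nat) (c : 'I_m -> 'I_m -> 'I_m -> k) (psi : 'I_m -> ps I),
    is_hom F (Gmul c) psi /\ forall f : ps I, exists g : ps 'I_m, pscomp g psi = f.

(* The example: coordinates (x_2,x_3) are indices 0,1 of 'I_2. *)
Definition i2 : 'I_2 := ord0.
Definition i3 : 'I_2 := ord_max.

Definition Fex : 'I_2 -> ps ('I_2 + 'I_2)%type :=
  fun i => psmul (psadd (psx i) (psy i))
                 (psgeom (psadd (psmul (psx i2) (psy i3)) (psmul (psx i3) (psy i2)))).

End PowerSeries.

(* Main.v *)
Require Import Defs.
From HB Require Import structures.
From mathcomp Require Import all_boot all_order all_algebra.
From mathcomp Require Import ring zify.
From Stdlib Require Import Classical.
Import GRing.Theory.
Set Implicit Arguments. Unset Strict Implicit. Unset Printing Implicit Defensive.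
Local Open Scope ring_scope.

(** Let [v i j] in [k^m] be the vector of coefficients of [x_2^i x_3^j] in a
    homomorphism [psi : F -> G].  Comparing the coefficients of [y_2] and
    [y_2^2] (with [y_3 = 0]) in [psi (F (x, y)) = G (psi x, psi y)] shows that
    the span of [1] and the [psi_t] is stable under the operators
    [X = d_2 - x_3 (x_2 d_2 + x_3 d_3)] and [N = X^2 - 2 P = x_3 d_2], where [P]
    is the operator given by the coefficient of [y_2^2].  Dually, there are
    matrices [L] and [M] acting on the vectors [v i j] as the transposes of [X]
    and [N].  Let [U] be the span of all [v i j].  Then [T = U M] contains every
    [v i.+1 j], and modulo [T] the matrix [L] maps [v 0 j.+1] to [- j v 0 j]; in
    characteristic [0] and finite dimension this forces [v 0 j] to lie in [T].
    Hence [U M = U], so [M] is injective on [U]; but [v 1 0] is killed by [M],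
    hence [v 1 0 = 0], and then no [g o psi] can be equal to [x_2]. *)

Lemma natr_neq0 (k : fieldType) : [pchar k] =i pred0 -> forall n, n.+1%:R != 0 :> k.
Proof. by move=> /pcharf0P hk n; rewrite hk. Qed.

(** * Spans of the coefficient vectors *)

Section LinearAlgebra.
Variable k : fieldType.

(** The family may be infinite, so its span is built by adjoining missing vectors one at a time.
    Each of them raises the rank, so the codimension bound [r] drops until either no vector is
    missing or [U] is full. *)
Lemma family_span (m : nat) (T : Type) (v : T -> 'rV[k]_m) :
  exists U : 'M[k]_m, (forall t, (v t <= U)%MS) /\
    (forall B : 'M[k]_m, (forall t, (v t <= B)%MS) -> (U <= B)%MS).
Proof.
suff H : forall r (U : 'M[k]_m), (m - \rank U <= r)%N ->
    (forall B : 'M[k]_m, (forall t, (v t <= B)%MS) -> (U <= B)%MS) ->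
    exists U' : 'M[k]_m, (forall t, (v t <= U')%MS) /\
    (forall B : 'M[k]_m, (forall t, (v t <= B)%MS) -> (U' <= B)%MS).
  by apply: (H m 0) => [|B _]; [rewrite leq_subr | rewrite sub0mx].
elim=> [|r IH] U hr hU.
  exists U; split=> // t; apply: submx_full.
  by rewrite /row_full eqn_leq rank_leq_col /=; lia.
have [h|/not_all_ex_not [t /negP ht]] := classic (forall t, (v t <= U)%MS).
  by exists U.
apply: (IH (U + v t)%MS); last first.
  by move=> B hB; rewrite addsmx_sub hU ?hB.
suff : (\rank U < \rank (U + v t)%MS)%N by lia.
rewrite ltn_neqAle mxrankS ?addsmxSl // andbT; apply: contra ht => /eqP e.
have /mxrank_leqif_sup := addsmxSl U (v t).
by move=> [_]; rewrite e eqxx => /esym h; apply: submx_trans h; apply: addsmxSr.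
Qed.

(** The preimage of [B] under [A] is the kernel of [A *m cokermx B], hence itself a matrix to which
    minimality of [U] applies. *)
Lemma span_mul_sub (m : nat) (T : Type) (v : T -> 'rV[k]_m) (U A B : 'M[k]_m) :
  (forall C : 'M[k]_m, (forall t, (v t <= C)%MS) -> (U <= C)%MS) ->
  (forall t, (v t *m A <= B)%MS) -> (U *m A <= B)%MS.
Proof.
move=> hU h; rewrite submxE -mulmxA -sub_kermx; apply: hU => t.
by rewrite sub_kermx mulmxA -submxE.
Qed.

Hypothesis hk : [pchar k] =i pred0.

(** The relation for [L] is asked only away from [i = j = 0]: there the coefficient of $y_2$ also
    receives the summand $\psi(y)$ of $G$. *)
Lemma coefficient_vectors_vanish (m : nat) (v : nat -> nat -> 'rV[k]_m) (L M : 'M[k]_m) :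
  v 0 0 = 0 ->
  (forall i j, v i j *m M = (if j is j'.+1 then i.+1%:R *: v i.+1 j' else 0)) ->
  (forall i j, (0 < i + j)%N -> v i j *m L = i.+1%:R *: v i.+1 j -
      (if j is j'.+1 then (i + j')%:R *: v i j' else 0)) ->
  v 1 0 = 0.
Proof.
move=> v00 hM hL.
have [U [vU minU]] := family_span (fun t : nat * nat => v t.1 t.2).
have {}vU i j : (v i j <= U)%MS by apply: (vU (i, j)).
pose T := U *m M.
have vT i j : (v i.+1 j <= T)%MS.
  rewrite -(eqmx_scale _ (natr_neq0 hk i)) -(hM i j.+1).
  exact: submxMr.
(* [M] raises the first index to at least 1 and [L] never lowers it, so only vectors [v i.+1 j]
   occur, all of them in [T]. *)
have TL : (T *m L <= T)%MS.
  rewrite /T -mulmxA; apply: (span_mul_sub minU) => -[i j] /=.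
  rewrite mulmxA hM; case: j => [|j]; first by rewrite mul0mx sub0mx.
  rewrite -scalemxAl; apply: scalemx_sub; rewrite hL //.
  apply: addmx_sub; first by apply: scalemx_sub.
  by case: j => [|j]; rewrite ?oppr0 ?sub0mx // -scaleNr; apply: scalemx_sub.
(* [Tn n] is [T] enlarged by [v 0 1, ..., v 0 n]; [L] lowers this filtration by one step. *)
pose Tn := fix Tn n : 'M[k]_m := if n is p.+1 then (Tn p + v 0 p.+1)%MS else T.
have TTn n : (T <= Tn n)%MS.
  by elim: n => //= n IH; apply: submx_trans IH (addsmxSl _ _).
have TnL n : (Tn n.+1 *m L <= Tn n)%MS.
  elim: n => [|n IH].
    rewrite /= addsmxMr addsmx_sub TL hL // add0n scale0r subr0.
    by apply: scalemx_sub.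
  rewrite [Tn n.+2]/= addsmxMr addsmx_sub; apply/andP; split.
    by apply: submx_trans IH _; rewrite addsmxSl.
  rewrite hL //; apply: addmx_sub.
    by apply: scalemx_sub; apply: submx_trans (vT _ _) (TTn _).
  by rewrite -scaleNr; apply: scalemx_sub; rewrite /= addsmxSr.
(* Applying [L] turns [v 0 n.+2] into [v 1 n.+2 - n.+1%:R *: v 0 n.+1]; the first term lies in [T],
   and characteristic 0 allows division by [n.+1]. *)
have step n : (v 0 n.+2 <= Tn n.+1)%MS -> (v 0 n.+1 <= Tn n)%MS.
  move=> /(submxMr L) /submx_trans /(_ (TnL n)); rewrite hL // add0n => h.
  rewrite -(eqmx_scale _ (natr_neq0 hk n)).
  have -> : n.+1%:R *: v 0 n.+1 =
      1%:R *: v 1%N n.+2 - (1%:R *: v 1%N n.+2 - n.+1%:R *: v 0 n.+1).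
    by rewrite opprB addrC subrK.
  apply: addmx_sub; first by apply: scalemx_sub; apply: submx_trans (vT _ _) (TTn _).
  by rewrite -scaleN1r; apply: scalemx_sub.
(* By the contrapositive of [step], one failure at [n] gives failures at all later indices. The
   filtration then grows strictly forever, and its rank exceeds [m]. *)
have wT n : (v 0 n.+1 <= Tn n)%MS.
  apply: contraT => h0.
  have h s : ~~ (v 0 (n + s).+1 <= Tn (n + s)%N)%MS.
    by elim: s => [|s IH]; rewrite ?addn0 // addnS; apply: contra IH => /step.
  have r s : (s <= \rank (Tn (n + s)%N))%N.
    elim: s => // s IH; apply: leq_ltn_trans IH _.
    rewrite addnS /= ltn_neqAle mxrankS ?addsmxSl // andbT.
    apply: contra (h s) => /eqP e.
    have /mxrank_leqif_sup [_] := addsmxSl (Tn (n + s)%N) (v 0 (n + s).+1).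
    by rewrite e eqxx => /esym h1; apply: submx_trans h1; apply: addsmxSr.
  by have := leq_trans (r m.+1) (rank_leq_col _); rewrite ltnn.
have TnT n : (Tn n <= T)%MS.
  by elim: n => //= n IH; rewrite addsmx_sub IH (submx_trans (wT n) IH).
have UT : (U <= T)%MS.
  apply: minU => -[[|i] j] //=; case: j => [|j]; first by rewrite v00 sub0mx.
  exact: submx_trans (wT j) (TnT j).
(* Since [U *m M] has the rank of [U], the space [U] meets the kernel of [M] trivially, while
   [v 1 0] lies in both. *)
have := mxrank_mul_ker U M.
have -> : \rank (U *m M) = \rank U.
  by apply/eqP; rewrite eqn_leq mxrankM_maxl mxrankS.
move=> /eqP; rewrite -[X in _ == X]addn0 eqn_add2l mxrank_eq0 => /eqP e.
apply/eqP; rewrite -submx0 -e sub_capmx vU; apply/sub_kermxP.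
exact: hM.
Qed.
End LinearAlgebra.

(** * Comparison of power series with truncated polynomials *)

Section Series.
Variable k : fieldType.
Local Notation I4 := ('I_2 + 'I_2)%type.
Local Notation ring3 := {poly {poly {poly k}}}.

Definition mi2 (i j : nat) : mi 'I_2 := [ffun s => if s == i2 then i else j].
Definition mi3 (i j l : nat) : mi I4 :=
  [ffun v => match v with
             | inl s => if s == i2 then i else j
             | inr s => if s == i2 then l else 0%N
             end].

Lemma ord2P (s : 'I_2) : s = i2 \/ s = i3.
Proof. by case: s => -[|[|]] //= h; [left|right]; apply: val_inj. Qed.

Lemma mdeg_mi3 i j l : mdeg (mi3 i j l) = (i + j + l)%N.
Proof.
by rewrite /mdeg big_sumType /= !big_ord_recl !big_ord0 !ffunE /= !addn0.
Qed.

(** A divisor of a monomial free of $y_3$ is free of $y_3$, so the Cauchy product stays within the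
    indices [mi3]. The order of summation follows the nesting of [ring3], outermost variable
    first. *)
Lemma psmul_mi3 (f g : ps k I4) i j l :
  psmul f g (mi3 i j l) = \sum_(l' < l.+1) \sum_(j' < j.+1) \sum_(i' < i.+1)
    f (mi3 i' j' l') * g (mi3 (i - i') (j - j') (l - l')).
Proof.
rewrite /psmul; set N := mdeg _.
have eN : N = (i + j + l)%N by rewrite /N mdeg_mi3.
have ub n (t : 'I_n.+1) : (n <= N)%N -> (t < N.+1)%N.
  by move=> h; apply: leq_trans (ltn_ord t) _.
(* [h] and [h'] exchange exponent vectors and triples; [inord] loses nothing because every exponent
   is at most [N = i + j + l]. *)
pose h (p : 'I_l.+1 * ('I_j.+1 * 'I_i.+1)) : {ffun I4 -> 'I_N.+1} :=
  [ffun v => inord (mi3 p.2.2 p.2.1 p.1 v)].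
pose h' (b : {ffun I4 -> 'I_N.+1}) : 'I_l.+1 * ('I_j.+1 * 'I_i.+1) :=
  (inord (b (inr i2)), (inord (b (inl i3)), inord (b (inl i2)))).
have hE p v : h p v = mi3 p.2.2 p.2.1 p.1 v :> nat.
  rewrite ffunE inordK // ffunE.
  by case: v => s; case: (s == i2) => //; apply: ub; lia.
rewrite (reindex_onto h h') /=; last first.
  move=> b /forallP hb; apply/ffunP => v; apply: val_inj.
  have B u : (b u <= mi3 i j l u)%N by apply: hb.
  rewrite /= hE /h' /= ffunE.
  case: v => s; case: (ord2P s) => -> /=.
  - by rewrite inordK //; have := B (inl i2); rewrite ffunE.
  - by rewrite inordK //; have := B (inl i3); rewrite ffunE.
  - by rewrite inordK //; have := B (inr i2); rewrite ffunE.
  - by have := B (inr i3); rewrite ffunE /= leqn0 => /eqP ->.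
rewrite (eq_bigl xpredT) /=; last first.
  move=> [l' [j' i']]; apply/andP; split.
    apply/forallP => v; have := hE (l', (j', i')) v => ->; rewrite !ffunE /=.
    by case: v => s; case: (s == i2) => //; rewrite -ltnS.
  rewrite /h' !xpair_eqE -!val_eqE /= !hE !ffunE /=.
  by rewrite !inordK ?eqxx.
rewrite (eq_bigr (fun p : 'I_l.+1 * ('I_j.+1 * 'I_i.+1) =>
   f (mi3 p.2.2 p.2.1 p.1) * g (mi3 (i - p.2.2) (j - p.2.1) (l - p.1)))); last first.
  move=> p _; congr (f _ * g _); apply/ffunP => v; rewrite ffunE.
    exact: hE.
  have := hE p v => ->; rewrite !ffunE.
  by case: v => s; case: (s == i2).
rewrite -(pair_bigA _ (fun (l' : 'I_l.+1) (q : 'I_j.+1 * 'I_i.+1) => f (mi3 q.2 q.1 l') *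
   g (mi3 (i - q.2) (j - q.1) (l - l')))) /=.
apply: eq_bigr => l' _.
by rewrite -(pair_bigA _ (fun (j' : 'I_j.+1) (i' : 'I_i.+1) => f (mi3 i' j' l') *
   g (mi3 (i - i') (j - j') (l - l')))).
Qed.

(* Here [x_2], [x_3], [y_2] are ['X%:P%:P], ['X%:P], ['X]; series are compared at [y_3 = 0]. *)
Definition agree (N : nat) (f : ps k I4) (P : ring3) : Prop :=
  forall i j l, (i <= N)%N -> (j <= N)%N -> (l <= N)%N -> f (mi3 i j l) = P`_l`_j`_i.

Lemma agree_add N f g P Q : agree N f P -> agree N g Q -> agree N (psadd f g) (P + Q).
Proof. by move=> hf hg i j l hi hj hl; rewrite /psadd hf // hg // !coefD. Qed.

Lemma agree_opp N f P : agree N f P -> agree N (psopp f) (- P).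
Proof. by move=> hf i j l hi hj hl; rewrite /psopp hf // !coefN. Qed.

(** Coefficients of a product with exponents at most [N] involve only such coefficients of the
    factors, so the bound does not shrink. *)
Lemma agree_mul N f g P Q : agree N f P -> agree N g Q -> agree N (psmul f g) (P * Q).
Proof.
move=> hf hg i j l hi hj hl; rewrite psmul_mi3 coefM !coef_sum.
apply: eq_bigr => l' _; rewrite coefM coef_sum.
apply: eq_bigr => j' _; rewrite coefM.
apply: eq_bigr => i' _.
have := ltn_ord i'; have := ltn_ord j'; have := ltn_ord l' => h1 h2 h3.
by rewrite hf ?hg //; lia.
Qed.

Lemma agree1 N : agree N (@ps1 k I4) 1.
Proof.
move=> i j l _ _ _; rewrite /ps1 coef1.
have -> : [forall v, mi3 i j l v == 0%N] = [&& l == 0, j == 0 & i == 0]%N.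
  apply/forallP/and3P => [h|[/eqP -> /eqP -> /eqP ->] v].
    by have := (h (inl i2), h (inl i3), h (inr i2)); rewrite !ffunE /= => -[[-> ->] ->].
  by rewrite ffunE; case: v => s; case: ifP.
by do 3 (rewrite ?coef1 ?coef0 //; case: eqP => //= _); rewrite ?coef1 ?coef0.
Qed.

Lemma agree_exp N f P t : agree N f P -> agree N (psexp f t) (P ^+ t).
Proof.
move=> h; elim: t => [|t IH]; first exact: agree1.
by rewrite exprS; apply: agree_mul.
Qed.

Lemma agree_prod N (J : finType) (f : J -> ps k I4) (P : J -> ring3) :
  (forall v, agree N (f v) (P v)) -> agree N (psprod f) (\prod_v P v).
Proof.
move=> h; rewrite /psprod; apply: (big_ind2 (agree N)) => //.
- exact: agree1.
- by move=> f1 P1 f2 P2; apply: agree_mul.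
Qed.

Definition bimonomial (i j : nat) : {poly {poly k}} := 'X^j * ('X^i)%:P.
Definition monomial (i j l : nat) : ring3 := 'X^l * (bimonomial i j)%:P.

Lemma coef_bimonomial i j i' j' :
  (bimonomial i j)`_j'`_i' = ((i' == i) && (j' == j))%:R.
Proof.
rewrite coefMC coefXn andbC; case: (j' == j) => /=; last by rewrite mul0r coef0.
by rewrite mul1r coefXn.
Qed.

Lemma coef_monomial i j l i' j' l' :
  (monomial i j l)`_l'`_j'`_i' = [&& l' == l, j' == j & i' == i]%:R.
Proof.
rewrite coefMC coefXn; case: (l' == l) => /=; last by rewrite mul0r !coef0.
by rewrite mul1r coef_bimonomial andbC.
Qed.

Lemma agree_psX N (v : I4) i j l :
  (forall i' j' l', (mi3 i' j' l' == [ffun u => nat_of_bool (u == v)])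
     = [&& l' == l, j' == j & i' == i]) -> agree N (psX k v) (monomial i j l).
Proof.
move=> h i' j' l' _ _ _; rewrite coef_monomial -h /psX.
have -> : [forall u, mi3 i' j' l' u == nat_of_bool (u == v)] =
          (mi3 i' j' l' == [ffun u => nat_of_bool (u == v)]).
  apply/forallP/eqP => [e|e u]; last by rewrite e ffunE.
  by apply/ffunP => u; rewrite (eqP (e u)) ffunE.
by case: (_ == _).
Qed.

Lemma agree_x2 N : agree N (psx k i2) (monomial 1 0 0).
Proof.
apply: agree_psX => i j l; apply/eqP/and3P => [/ffunP h|[/eqP -> /eqP -> /eqP ->]].
  by have := (h (inl i2), h (inl i3), h (inr i2)); rewrite !ffunE /= => -[[-> ->] ->].
by apply/ffunP => -[s|s]; rewrite !ffunE; case: (ord2P s) => ->.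
Qed.

Lemma agree_x3 N : agree N (psx k i3) (monomial 0 1 0).
Proof.
apply: agree_psX => i j l; apply/eqP/and3P => [/ffunP h|[/eqP -> /eqP -> /eqP ->]].
  by have := (h (inl i2), h (inl i3), h (inr i2)); rewrite !ffunE /= => -[[-> ->] ->].
by apply/ffunP => -[s|s]; rewrite !ffunE; case: (ord2P s) => ->.
Qed.

Lemma agree_y2 N : agree N (psy k i2) (monomial 0 0 1).
Proof.
apply: agree_psX => i j l; apply/eqP/and3P => [/ffunP h|[/eqP -> /eqP -> /eqP ->]].
  by have := (h (inl i2), h (inl i3), h (inr i2)); rewrite !ffunE /= => -[[-> ->] ->].
by apply/ffunP => -[s|s]; rewrite !ffunE; case: (ord2P s) => ->.
Qed.

Lemma agree_y3 N : agree N (psy k i3) 0.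
Proof.
move=> i j l _ _ _; rewrite !coef0 /psy /psX.
by case: forallP => // /(_ (inr i3)); rewrite ffunE.
Qed.

Lemma pscomp_mi2 (I : finType) (f : ps k 'I_2) (phi : 'I_2 -> ps k I) a :
  pscomp f phi a = \sum_(p < (mdeg a).+1) \sum_(q < (mdeg a).+1)
    f (mi2 p q) * psprod (fun s => psexp (phi s) (mi2 p q s)) a.
Proof.
rewrite /pscomp; set N := mdeg a.
pose h (p : 'I_N.+1 * 'I_N.+1) : {ffun 'I_2 -> 'I_N.+1} :=
  [ffun s => if s == i2 then p.1 else p.2].
pose h' (b : {ffun 'I_2 -> 'I_N.+1}) := (b i2, b i3).
rewrite (reindex h) /=; last first.
  exists h' => [[p q] _|b _]; first by rewrite /h' !ffunE.
  by apply/ffunP => s; rewrite ffunE /=; case: (ord2P s) => ->.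
rewrite pair_bigA /=; apply: eq_bigr => -[p q] _ /=.
have e s : nat_of_ord (h (p, q) s) = mi2 p q s.
  by rewrite !ffunE /=; case: ifP.
have -> : psprod (fun s => psexp (phi s) (h (p, q) s)) =
          psprod (fun s => psexp (phi s) (mi2 p q s)).
  by apply: eq_bigr => s _; rewrite e.
by congr (f _ * _); apply/ffunP => s; rewrite ffunE.
Qed.

Lemma sum_delta (n : nat) (h : nat -> nat -> k) s t : (s < n)%N -> (t < n)%N ->
  \sum_(p < n) \sum_(q < n) h p q * ((p == s :> nat) && (q == t :> nat))%:R = h s t.
Proof.
move=> hs ht; rewrite (bigD1 (Ordinal hs)) //= [X in _ + X]big1 => [|p hp].
  rewrite addr0 (bigD1 (Ordinal ht)) //= [X in _ + X]big1 => [|q hq].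
    by rewrite !eqxx mulr1 addr0.
  by rewrite eqxx -[(q == t :> nat)]/(q == Ordinal ht) (negbTE hq) mulr0.
apply: big1 => q _.
by rewrite -[(p == s :> nat)]/(p == Ordinal hs) (negbTE hp) mulr0.
Qed.

Lemma psprod_mi3 N (phi : 'I_2 -> ps k I4) (P : 'I_2 -> ring3) p q i j l :
  (forall s, agree N (phi s) (P s)) -> (i <= N)%N -> (j <= N)%N -> (l <= N)%N ->
  psprod (fun s => psexp (phi s) (mi2 p q s)) (mi3 i j l) =
  (P i2 ^+ p * P i3 ^+ q)`_l`_j`_i.
Proof.
move=> h hi hj hl.
rewrite (agree_prod (P := fun s => P s ^+ mi2 p q s) (N := N)) //; last first.
  by move=> s; apply: agree_exp.
rewrite big_ord_recl big_ord1 !ffunE /=.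
by have -> : lift ord0 ord0 = i3 by apply: val_inj.
Qed.

Lemma monomialX i j l n : monomial i j l ^+ n = monomial (i * n) (j * n) (l * n).
Proof.
by rewrite /monomial /bimonomial exprMn -polyC_exp exprMn -polyC_exp -!exprM.
Qed.

Lemma monomialM i j l i' j' l' :
  monomial i j l * monomial i' j' l' = monomial (i + i') (j + j') (l + l').
Proof.
rewrite /monomial /bimonomial !exprD !polyCM; ring.
Qed.

Lemma pscomp_psx (f : ps k 'I_2) i j l :
  pscomp f (@psx k 'I_2) (mi3 i j l) = (l == 0)%:R * f (mi2 i j).
Proof.
rewrite pscomp_mi2 mdeg_mi3; set n := (i + j + l)%N.
pose P (s : 'I_2) := if s == i2 then monomial 1 0 0 else monomial 0 1 0.
have hP s : agree n (psx k s) (P s).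
  by case: (ord2P s) => ->; [apply: agree_x2 | apply: agree_x3].
rewrite -(@sum_delta n.+1 (fun p q => (l == 0)%:R * f (mi2 p q)) i j) ?ltnS; [|lia..].
apply: eq_bigr => p _; apply: eq_bigr => q _.
rewrite (psprod_mi3 _ _ hP) ?/n; [|lia..].
rewrite /P /= !monomialX monomialM coef_monomial !mul0n !mul1n !addn0 !add0n.
by rewrite (eq_sym j) (eq_sym i); do 3 case: (_ == _); rewrite /= ?mulr1 ?mulr0 ?mul1r ?mul0r.
Qed.

Lemma pscomp_psy (f : ps k 'I_2) i j l :
  pscomp f (@psy k 'I_2) (mi3 i j l) = ((i == 0) && (j == 0))%:R * f (mi2 l 0).
Proof.
rewrite pscomp_mi2 mdeg_mi3; set n := (i + j + l)%N.
pose P (s : 'I_2) := if s == i2 then monomial 0 0 1 else 0.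
have hP s : agree n (psy k s) (P s).
  by case: (ord2P s) => ->; [apply: agree_y2 | apply: agree_y3].
rewrite -(@sum_delta n.+1 (fun p q => ((i == 0) && (j == 0))%:R * f (mi2 p q)) l 0) ?ltnS; [|lia..].
apply: eq_bigr => p _; apply: eq_bigr => q _.
rewrite (psprod_mi3 _ _ hP) ?/n; [|lia..].
rewrite /P /= !monomialX expr0n; case: (nat_of_ord q == 0) => /=; last first.
  by rewrite mulr0 !coef0 andbF !mulr0.
rewrite mulr1 coef_monomial !mul0n mul1n (eq_sym l) andbT.
by do 3 case: (_ == _); rewrite /= ?mulr1 ?mulr0 ?mul1r ?mul0r.
Qed.

(** This gives an arbitrary series a polynomial that agrees with it up to [N], so that the ring laws
    of [ring3] become available. *)
Definition trunc (N : nat) (f : ps k I4) : ring3 :=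
  \poly_(l < N.+1) \poly_(j < N.+1) \poly_(i < N.+1) f (mi3 i j l).

Lemma agree_trunc N f : agree N f (trunc N f).
Proof.
by move=> i j l hi hj hl; rewrite coef_poly ltnS hl coef_poly ltnS hj coef_poly ltnS hi.
Qed.

(** * Composition of series, and the coefficients of the product $G$ *)

Section Composition.
Variables (I J : finType).
Implicit Types (f g : ps k J) (phi : J -> ps k I).

Lemma pscomp_add f g phi a : pscomp (psadd f g) phi a = pscomp f phi a + pscomp g phi a.
Proof. by rewrite -big_split; apply: eq_bigr => b _; rewrite mulrDl. Qed.

Lemma pscomp_scale c f phi a : pscomp (psscale c f) phi a = c * pscomp f phi a.
Proof. by rewrite big_distrr; apply: eq_bigr => b _; rewrite -mulrA. Qed.

Lemma pscomp_sum (K : finType) (F : K -> ps k J) phi a :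
  pscomp (pssum F) phi a = \sum_t pscomp (F t) phi a.
Proof.
apply: (big_morph (fun f => pscomp f phi a)) => [f g|]; first exact: pscomp_add.
by apply: big1 => b _; rewrite mul0r.
Qed.

(** The sum defining [pscomp] is cut off at exponents [mdeg a]; the bound on [c] keeps the only
    contributing monomial inside that range. *)
Lemma pscomp_delta f (c : mi J) phi a :
  (forall b, f b = (b == c)%:R) -> (forall v, c v <= mdeg a)%N ->
  pscomp f phi a = psprod (fun v => psexp (phi v) (c v)) a.
Proof.
move=> hf hc; pose b0 : {ffun J -> 'I_(mdeg a).+1} := [ffun v => inord (c v)].
have b0E v : b0 v = c v :> nat by rewrite ffunE inordK // ltnS hc.
rewrite /pscomp (bigD1 b0) //= [X in _ + X]big1 ?addr0 => [|b hb].
  have -> : psprod (fun v => psexp (phi v) (b0 v)) = psprod (fun v => psexp (phi v) (c v)).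
    by apply: eq_bigr => v _; rewrite b0E.
  rewrite hf; have -> : [ffun v => nat_of_ord (b0 v)] = c by apply/ffunP => v; rewrite ffunE b0E.
  by rewrite eqxx mul1r.
rewrite hf; case: eqP => [e|]; last by rewrite mul0r.
case/eqP: hb; apply/ffunP => v; apply: val_inj; rewrite /= b0E -e.
by rewrite ffunE.
Qed.

Lemma psX_delta (v : J) b : psX k v b = (b == [ffun u => nat_of_bool (u == v)])%:R.
Proof.
rewrite /psX; case: forallP => h; case: eqP => //.
- by case; apply/ffunP => u; rewrite (eqP (h u)) ffunE.
- by move=> e; case: h => u; rewrite e ffunE.
Qed.

Lemma psXM_delta (u v : J) b : psmul (psX k u) (psX k v) b =
  (b == [ffun w => ((w == u) + (w == v))%N])%:R.
Proof.
case: (boolP (b == _)) => [/eqP ->|hb]; last first.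
  apply: big1 => b' /forallP le_b'; rewrite !psX_delta.
  case: eqP => [e1|]; last by rewrite mul0r.
  case: eqP => [e2|]; last by rewrite mulr0.
  case/eqP: hb; apply/ffunP => w.
  move/ffunP: e1 => /(_ w); move/ffunP: e2 => /(_ w); rewrite !ffunE => <- <-.
  by rewrite subnKC.
set c := [ffun w => _]; rewrite /psmul.
have le1 w : ((w == u) < (mdeg c).+1)%N.
  case: (w == u) => //=; rewrite ltnS /mdeg (bigD1 u) //= ffunE eqxx; lia.
pose b0 : {ffun J -> 'I_(mdeg c).+1} := [ffun w => Ordinal (le1 w)].
rewrite (bigD1 b0) /=; last by apply/forallP => w; rewrite !ffunE /= leq_addr.
rewrite [X in _ + X]big1 ?addr0 => [|b' /andP [_ hb]].
  rewrite !psX_delta.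
  have -> : [ffun w => nat_of_ord (b0 w)] == [ffun w => nat_of_bool (w == u)].
    by apply/eqP/ffunP => w; rewrite !ffunE.
  have -> : [ffun w => (c w - b0 w)%N] == [ffun w => nat_of_bool (w == v)].
    by apply/eqP/ffunP => w; rewrite !ffunE /= addKn.
  by rewrite mulr1.
rewrite psX_delta; case: eqP => [e|]; last by rewrite mul0r.
case/eqP: hb; apply/ffunP => w; apply: val_inj.
by move/ffunP: e => /(_ w); rewrite !ffunE.
Qed.
End Composition.

Lemma prod_expr_delta (J : finType) (P : J -> ring3) u : \prod_w P w ^+ (w == u) = P u.
Proof.
by rewrite (bigD1 u) //= eqxx big1 ?mulr1 // => w /negbTE ->.
Qed.

Section CompositionAtMi3.
Variables (J : finType) (phi : J -> ps k I4) (i j l : nat).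
Hypothesis l_gt0 : (0 < l)%N.

Lemma pscomp_psX v : pscomp (psX k v) phi (mi3 i j l) = phi v (mi3 i j l).
Proof.
pose N := (i + j + l)%N; rewrite (pscomp_delta phi (psX_delta v)); last first.
  by move=> u; rewrite ffunE mdeg_mi3; case: (u == v) => //=; lia.
rewrite (agree_prod (N := N) (P := fun u => trunc N (phi u) ^+ (u == v))) ?/N; [|move=> u|lia..].
  by rewrite prod_expr_delta -(agree_trunc (phi v)) ?/N //; lia.
by rewrite ffunE; apply/agree_exp/agree_trunc.
Qed.

(** With [u != v] all exponents of the monomial are at most 1, and [l_gt0] makes the cut-off degree
    at least 1. *)
Lemma pscomp_psXM u v : u != v ->
  pscomp (psmul (psX k u) (psX k v)) phi (mi3 i j l) = psmul (phi u) (phi v) (mi3 i j l).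
Proof.
move=> huv.
pose N := (i + j + l)%N; rewrite (pscomp_delta phi (psXM_delta u v)); last first.
  move=> w; rewrite ffunE mdeg_mi3; case: (eqVneq w u) => [->|_].
    by rewrite (negbTE huv) /=; lia.
  by case: (w == v) => /=; lia.
pose P w := trunc N (phi w); have hP w : agree N (phi w) (P w) by apply: agree_trunc.
rewrite (agree_prod (N := N) (P := fun w => P w ^+ (w == u) * P w ^+ (w == v))) ?/N; [|move=> w|lia..].
  rewrite big_split /= !prod_expr_delta.
  by rewrite (agree_mul (hP u) (hP v)) ?/N //; lia.
by rewrite ffunE -exprD; apply: agree_exp.
Qed.
End CompositionAtMi3.

(** At a mixed monomial the summands $\psi(x)$ and $\psi(y)$ of $G$ contribute nothing, since one
    has no $y_2$ and the other no $x$. Only the bilinear term is left. *)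
Lemma Gmul_side (m : nat) (c : 'I_m -> 'I_m -> 'I_m -> k) (psi : 'I_m -> ps k 'I_2) t i j l :
  (0 < l)%N -> (0 < i + j)%N ->
  pscomp (Gmul c t) (fun v => match v with
      | inl s => pscomp (psi s) (@psx k 'I_2)
      | inr s => pscomp (psi s) (@psy k 'I_2) end) (mi3 i j l) =
  \sum_s psi s (mi2 i j) * \sum_r c s r t * psi r (mi2 l 0).
Proof.
move=> l0 ij0; rewrite /Gmul !pscomp_add !pscomp_psX // pscomp_psx pscomp_psy.
have -> : (l == 0)%N = false by lia.
have -> : (i == 0)%N && (j == 0)%N = false by lia.
rewrite !mul0r !add0r pscomp_sum; apply: eq_bigr => s _.
rewrite pscomp_sum big_distrr; apply: eq_bigr => r _.
rewrite pscomp_scale pscomp_psXM //=.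
pose N := (i + j + l)%N.
(* [P] is constant in $y_2$ and [Q] is constant in $x_2, x_3$, so a coefficient of [P * Q] is a
   product of one coefficient from each. *)
pose P : ring3 := (\poly_(j < N.+1) \poly_(i < N.+1) psi s (mi2 i j))%:P.
pose Q : ring3 := \poly_(l < N.+1) (psi r (mi2 l 0))%:P%:P.
have hP : agree N (pscomp (psi s) (@psx k 'I_2)) P.
  move=> i' j' l' hi hj hl; rewrite pscomp_psx coefC; case: eqP => _ /=.
    by rewrite mul1r coef_poly ltnS hj coef_poly ltnS hi.
  by rewrite mul0r !coef0.
have hQ : agree N (pscomp (psi r) (@psy k 'I_2)) Q.
  move=> i' j' l' hi hj hl; rewrite pscomp_psy coef_poly ltnS hl coefC.
  case: (j' == 0)%N; last by rewrite andbF mul0r coef0.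
  by rewrite coefC andbT; case: (i' == 0)%N; rewrite ?mul1r ?mul0r.
rewrite (agree_mul hP hQ) ?/N; [|lia..].
rewrite coefCM coef_poly ltnS leq_addl !coefMC coef_poly.
have -> : (j < N.+1)%N by rewrite /N; lia.
rewrite coef_poly; have -> : (i < N.+1)%N by rewrite /N; lia.
ring.
Qed.

End Series.

(** * Low-order coefficients of the example *)

Section LowCoefficients.
Variable R : comNzRingType.
Implicit Types (P : {poly R}) (x z : R).

Lemma coefM1 P (Q : {poly R}) : (P * Q)`_1 = P`_0 * Q`_1 + P`_1 * Q`_0.
Proof. by rewrite coefM !big_ord_recl big_ord0 addr0. Qed.

Lemma coefM2 P (Q : {poly R}) : (P * Q)`_2 = P`_0 * Q`_2 + P`_1 * Q`_1 + P`_2 * Q`_0.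
Proof. by rewrite coefM !big_ord_recl big_ord0 addr0 !addrA. Qed.

(** [P] starts like $1/(1+zT)$, so these are the first binomial coefficients of $(1+zT)^{-n}$; the
    factor 2 avoids a denominator. *)
Lemma coef_geom_exp P z n : P`_0 = 1 -> P`_1 = - z -> P`_2 = z ^+ 2 ->
  [/\ (P ^+ n)`_0 = 1, (P ^+ n)`_1 = - (n%:R * z) &
      2 * (P ^+ n)`_2 = n%:R * n.+1%:R * z ^+ 2].
Proof.
move=> h0 h1 h2; elim: n => [|n [e0 e1 e2]]; first by rewrite expr0 !coef1; split=> //=; ring.
rewrite exprS; split.
- by rewrite coef0M h0 e0 mulr1.
- by rewrite coefM1 h0 h1 e0 e1; ring.
- rewrite coefM2 h0 h1 h2 e0 e1 !(mulrDr 2) mul1r e2; ring.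
Qed.

(** Where a predecessor is cut off at 0, the numerical factor in front vanishes. *)
Lemma coef_XD_exp x n :
  [/\ ((x%:P + 'X) ^+ n)`_0 = x ^+ n, ((x%:P + 'X) ^+ n)`_1 = n%:R * x ^+ n.-1 &
      2 * ((x%:P + 'X) ^+ n)`_2 = n%:R * n.-1%:R * x ^+ n.-2].
Proof.
elim: n => [|n [e0 e1 e2]]; first by rewrite expr0 !coef1; split=> //=; ring.
have c0 : (x%:P + 'X)`_0 = x by rewrite coefD coefC coefX addr0.
have c1 : (x%:P + 'X)`_1 = 1 by rewrite coefD coefC coefX add0r.
have c2 : (x%:P + 'X)`_2 = 0 by rewrite coefD coefC coefX add0r.
rewrite exprS; split.
- by rewrite coef0M c0 e0 exprS.
- rewrite coefM1 c0 c1 e0 e1; case: n {e0 e1 e2} => [|n] /=; rewrite ?exprS; ring.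
- rewrite coefM2 c0 c1 c2 e1 !(mulrDr 2) mulrCA e2.
  case: n {e0 e1 e2} => [|[|n]] /=; rewrite ?exprS; ring.
Qed.

(** With $T = y_2$, [Q] is the image of $x_2^p x_3^q$ under $F$ at $y_3 = 0$. Its first coefficient
    is the operator $X$ applied to this monomial, and twice its second is $2P$ applied to it. *)
Lemma coef_mul_geom P x z p q : P`_0 = 1 -> P`_1 = - z -> P`_2 = z ^+ 2 ->
  let Q := ((x%:P + 'X) * P) ^+ p * (z%:P * P) ^+ q in
  Q`_1 = p%:R * (z ^+ q * x ^+ p.-1) - (p + q)%:R * (z ^+ q.+1 * x ^+ p) /\
  2 * Q`_2 = (p * p.-1)%:R * (z ^+ q * x ^+ p.-2)
             - (2 * (p + q) * p)%:R * (z ^+ q.+1 * x ^+ p.-1)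
             + ((p + q) * (p + q).+1)%:R * (z ^+ q.+2 * x ^+ p).
Proof.
move=> h0 h1 h2 /=.
have [a0 a1 a2] := coef_XD_exp x p.
have [b0 b1 b2] := coef_geom_exp (p + q) h0 h1 h2.
have -> : ((x%:P + 'X) * P) ^+ p * (z%:P * P) ^+ q =
    (z ^+ q)%:P * ((x%:P + 'X) ^+ p * P ^+ (p + q)).
  by rewrite !exprMn exprD -polyC_exp; ring.
rewrite !coefCM coefM1 coefM2 a0 a1 b0 b1; split; first by rewrite exprS; ring.
transitivity (z ^+ q * (x ^+ p * (2 * (P ^+ (p + q))`_2) +
   2 * (p%:R * x ^+ p.-1) * - ((p + q)%:R * z) + 2 * ((x%:P + 'X) ^+ p)`_2)); first by ring.
by rewrite a2 b2 !exprS !natrM; ring.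
Qed.
End LowCoefficients.

(** * The coefficients of $y_2$ and $y_2^2$ in $f \circ F$ *)

Section Example.
Variable k : fieldType.
Local Notation I4 := ('I_2 + 'I_2)%type.
Local Notation ring3 := {poly {poly {poly k}}}.

(** This is $1/(1+x_3y_2)$ cut off in $y_2$: the inner ['X] is $x_3$. *)
Definition geom (N : nat) : ring3 := \poly_(t < N.+1) (- 'X) ^+ t.

(** At $y_3 = 0$ the denominator becomes $1 + x_3y_2$, and only the term [t = l] of the geometric
    sum reaches $y_2^l$. *)
Lemma agree_geom N :
  agree N (psgeom (psadd (psmul (psx k i2) (psy k i3)) (psmul (psx k i3) (psy k i2)))) (geom N).
Proof.
move=> i j l hi hj hl.
set u := psadd _ _; pose Z : ring3 := monomial k 0 1 1.
have hu M : agree M u Z.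
  have -> : Z = monomial k 1 0 0 * 0 + monomial k 0 1 0 * monomial k 0 0 1.
    by rewrite mulr0 add0r monomialM.
  apply: agree_add; apply: agree_mul; [exact: agree_x2|exact: agree_y3|exact: agree_x3|exact: agree_y2].
have cZ t : ((- Z) ^+ t)`_l = if l == t then (- 'X) ^+ t else 0.
  rewrite /Z /monomial /bimonomial !expr1 mulr1 -mulrN -polyCN exprMn -polyC_exp.
  rewrite coefMC coefXn; case: (l == t); rewrite ?mul1r ?mul0r //.
rewrite /psgeom mdeg_mi3 coef_poly ltnS hl.
have hl' : (l < (i + j + l).+1)%N by lia.
rewrite (bigD1 (Ordinal hl')) //= big1 ?addr0 => [|t ht].
  by rewrite (agree_exp l (agree_opp (hu N))) // cZ eqxx.
rewrite (agree_exp t (agree_opp (hu N))) // cZ.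
by rewrite eq_sym -[(_ == l :> nat)]/(t == Ordinal hl') (negbTE ht) !coef0.
Qed.

Lemma Fex_coef p q i j l (N := (i + j + l)%N) :
  psprod (fun s => psexp (Fex k s) (mi2 p q s)) (mi3 i j l) =
  ((('X%:P%:P + 'X) * geom N) ^+ p * ('X%:P * geom N) ^+ q)`_l`_j`_i.
Proof.
pose P (s : 'I_2) : ring3 := if s == i2 then ('X%:P%:P + 'X) * geom N else 'X%:P * geom N.
rewrite (psprod_mi3 (N := N) (P := P)) ?/N; [by []|move=> s|lia..].
case: (ord2P s) => ->; rewrite /P /Fex /=; (apply: agree_mul; last exact: agree_geom).
  have -> : 'X%:P%:P + 'X = monomial k 1 0 0 + monomial k 0 0 1.
    by rewrite /monomial /bimonomial !expr0 !expr1 !mul1r mulr1.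
  by apply: agree_add; [apply: agree_x2|apply: agree_y2].
have -> : 'X%:P = monomial k 0 1 0 + 0.
  by rewrite /monomial /bimonomial !expr0 !expr1 !mul1r mulr1 addr0.
by apply: agree_add; [apply: agree_x3|apply: agree_y3].
Qed.

Lemma bimonomialE i j : 'X ^+ j * 'X%:P ^+ i = bimonomial k i j.
Proof. by rewrite /bimonomial polyC_exp. Qed.

Lemma geom_coefs N : (2 <= N)%N ->
  [/\ (geom N)`_0 = 1, (geom N)`_1 = - 'X & (geom N)`_2 = 'X ^+ 2].
Proof.
by move=> h; have h1 := ltnW h; rewrite !coef_poly !ltnS leq0n h h1 expr0 expr1 sqrrN.
Qed.

Lemma natr_mul_coef (n : nat) (P : {poly {poly k}}) i j :
  (n%:R * P)`_j`_i = n%:R * P`_j`_i.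
Proof. by rewrite !mulr_natl !coefMn. Qed.

(** This is the transpose of $X$: the monomials of [f] whose image under $X$ contains $x_2^i x_3^j$
    are collected, [A] from $d_2$ and [B] from $x_3(x_2d_2+x_3d_3)$. The hypothesis gives [2 <= N],
    as [geom_coefs] requires. *)
Lemma Fex_side1 (f : ps k 'I_2) i j : (0 < i + j)%N ->
  pscomp f (Fex k) (mi3 i j 1) = i.+1%:R * f (mi2 i.+1 j) -
    (if j is j'.+1 then (i + j')%:R * f (mi2 i j') else 0).
Proof.
move=> ij0; rewrite pscomp_mi2 mdeg_mi3; set N := (i + j + 1)%N.
have [g0 g1 g2] : [/\ (geom N)`_0 = 1, (geom N)`_1 = - 'X & (geom N)`_2 = 'X ^+ 2].
  by apply: geom_coefs; rewrite /N; lia.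
pose A p q := p%:R * f (mi2 p q) * ((p == i.+1) && (q == j))%:R.
pose B p q := (p + q)%:R * f (mi2 p q) * ((p == i) && (q.+1 == j))%:R.
transitivity (\sum_(p < N.+1) \sum_(q < N.+1) (A p q - B p q)).
  apply: eq_bigr => p _; apply: eq_bigr => q _.
  rewrite Fex_coef (proj1 (coef_mul_geom _ _ _ g0 g1 g2)) !bimonomialE.
  rewrite !coefB !natr_mul_coef !coef_bimonomial /A /B (eq_sym i) (eq_sym j) (eq_sym j) (eq_sym i).
  (* At [p = 0] the exponent [p.-1] is spurious, but its factor [p%:R] is zero. *)
  by case: (nat_of_ord p) => [|p'] //=; rewrite ?eqSS; ring.
under eq_bigr do rewrite sumrB; rewrite sumrB; congr (_ - _).
  by rewrite (@sum_delta k N.+1 (fun p q => p%:R * f (mi2 p q))) // /N; lia.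
case: j {ij0 g0 g1 g2 A} @N @B => [|j] N B.
  by apply: big1 => p _; apply: big1 => q _; rewrite /B andbF mulr0.
rewrite -(@sum_delta k N.+1 (fun p q => (p + q)%:R * f (mi2 p q)) i j) /N; [|lia..].
by apply: eq_bigr => p _; apply: eq_bigr => q _.
Qed.

Lemma Fex_side2 (f : ps k 'I_2) i j :
  2 * pscomp f (Fex k) (mi3 i j 2) = (i.+2 * i.+1)%:R * f (mi2 i.+2 j)
    - (if j is j'.+1 then (2 * (i.+1 + j') * i.+1)%:R * f (mi2 i.+1 j') else 0)
    + (if j is j'.+2 then ((i + j') * (i + j').+1)%:R * f (mi2 i j') else 0).
Proof.
rewrite pscomp_mi2 mdeg_mi3; set N := (i + j + 2)%N.
have [g0 g1 g2] : [/\ (geom N)`_0 = 1, (geom N)`_1 = - 'X & (geom N)`_2 = 'X ^+ 2].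
  by apply: geom_coefs; rewrite /N; lia.
pose A p q := (p * p.-1)%:R * f (mi2 p q) * ((p == i.+2) && (q == j))%:R.
pose B p q := (2 * (p + q) * p)%:R * f (mi2 p q) * ((p == i.+1) && (q.+1 == j))%:R.
pose D p q := ((p + q) * (p + q).+1)%:R * f (mi2 p q) * ((p == i) && (q.+2 == j))%:R.
transitivity (\sum_(p < N.+1) \sum_(q < N.+1) (A p q - B p q + D p q)).
  rewrite big_distrr; apply: eq_bigr => p _; rewrite big_distrr; apply: eq_bigr => q _ /=.
  rewrite Fex_coef mulrCA -(natr_mul_coef 2).
  rewrite (proj2 (coef_mul_geom _ _ _ g0 g1 g2)) !bimonomialE.
  rewrite !coefD !coefN !natr_mul_coef !coef_bimonomial /A /B /D.
  rewrite ![i == _]eq_sym ![j == _]eq_sym.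
  by case: (nat_of_ord p) => [|[|p']] //=; rewrite ?eqSS; ring.
under eq_bigr do rewrite big_split sumrB /=.
rewrite big_split sumrB /=; congr (_ - _ + _).
- by rewrite (@sum_delta k N.+1 (fun p q => (p * p.-1)%:R * f (mi2 p q))) // /N; lia.
- case: j {g0 g1 g2 A D} @N @B => [|j] N B.
    by apply: big1 => p _; apply: big1 => q _; rewrite /B andbF mulr0.
  rewrite -(@sum_delta k N.+1 (fun p q => (2 * (p + q) * p)%:R * f (mi2 p q)) i.+1 j) /N; [|lia..].
  by apply: eq_bigr => p _; apply: eq_bigr => q _.
- case: j {g0 g1 g2 A B} @N @D => [|[|j]] N D.
  + by apply: big1 => p _; apply: big1 => q _; rewrite /D andbF mulr0.
  + by apply: big1 => p _; apply: big1 => q _; rewrite /D andbF mulr0.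
  rewrite -(@sum_delta k N.+1 (fun p q => ((p + q) * (p + q).+1)%:R * f (mi2 p q)) i j) /N; [|lia..].
  by apply: eq_bigr => p _; apply: eq_bigr => q _.
Qed.

(** In each term of the coefficient of $x_2$ one factor supplies $x_2$ and the other its constant
    term, which may be arbitrary. *)
Lemma psmul_mi2_10 (f g : ps k 'I_2) : f (mi2 1 0) = 0 -> g (mi2 1 0) = 0 ->
  psmul f g (mi2 1 0) = 0.
Proof.
move=> hf hg; apply: big1 => b /forallP hb.
have b3 : b i3 = 0 :> nat by have := hb i3; rewrite ffunE /= leqn0 => /eqP.
have := hb i2; rewrite ffunE /= leq_eqVlt ltnS leqn0 => /orP [/eqP b2|/eqP b2].
  have -> : [ffun s => nat_of_ord (b s)] = mi2 1 0.
    by apply/ffunP => s; rewrite !ffunE; case: (ord2P s) => ->.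
  by rewrite hf mul0r.
have -> : [ffun s => (mi2 1 0 s - b s)%N] = mi2 1 0.
  by apply/ffunP => s; rewrite !ffunE; case: (ord2P s) => -> /=; rewrite ?b2 ?b3.
by rewrite hg mulr0.
Qed.

Lemma pscomp_mi2_10 (J : finType) (g : ps k J) (psi : J -> ps k 'I_2) :
  (forall t, psi t (mi2 1 0) = 0) -> pscomp g psi (mi2 1 0) = 0.
Proof.
move=> h; have h1 : @ps1 k 'I_2 (mi2 1 0) = 0.
  by rewrite /ps1; case: forallP => // /(_ i2); rewrite ffunE.
apply: big1 => b _; apply/eqP; rewrite mulf_eq0; apply/orP; right; apply/eqP.
apply: (big_ind (fun f : ps k 'I_2 => f (mi2 1 0) = 0)) => //.
  by move=> f1 f2; apply: psmul_mi2_10.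
move=> t _; elim: (val (b t)) => //= n IH; exact: psmul_mi2_10.
Qed.
End Example.

(** * Non-linearity of the example *)

Theorem mainTheorem16 (k : fieldType) (hk : [pchar k]%R =i pred0) :
  ~ is_linear (Fex k).
Proof.
move=> [m [c [psi [[psi0 hom] surj]]]].
pose v i j : 'rV[k]_m := \row_t psi t (mi2 i j).
(* [K l] is right multiplication by [v l 0] in the algebra; [K 1] serves as [L], and [K 2] is the
   transpose of $P$. *)
pose K l : 'M[k]_m := \matrix_(s, t) \sum_r c s r t * psi r (mi2 l 0).
have vK i j l : (0 < l)%N -> (0 < i + j)%N ->
    v i j *m K l = \row_t pscomp (psi t) (Fex k) (mi3 i j l).
  move=> l0 ij0; apply/rowP => t; rewrite !mxE -hom Gmul_side //.
  by apply: eq_bigr => s _; rewrite !mxE.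
have hL i j : (0 < i + j)%N -> v i j *m K 1%N = i.+1%:R *: v i.+1 j -
      (if j is j'.+1 then (i + j')%:R *: v i j' else 0).
  move=> ij0; rewrite vK //; apply/rowP => t; rewrite !mxE Fex_side1 //.
  by case: j {ij0} => [|j]; rewrite !mxE.
have v00 : v 0 0 = 0.
  apply/rowP => t; rewrite !mxE; have -> : mi2 0 0 = [ffun => 0%N].
    by apply/ffunP => s; rewrite !ffunE; case: ifP.
  exact: psi0.
(* This is the transpose of $X^2 - 2P = x_3d_2$: all other terms cancel. *)
have hM i j : v i j *m (K 1%N *m K 1%N - 2 *: K 2%N) =
    (if j is j'.+1 then i.+1%:R *: v i.+1 j' else 0).
  have [e|ij0] := posnP (i + j).
    have [-> ->] : i = 0%N /\ j = 0%N by lia.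
    by rewrite v00 mul0mx.
  rewrite mulmxBr mulmxA hL // -scalemxAr vK //.
  have -> : 2 *: (\row_t pscomp (psi t) (Fex k) (mi3 i j 2)) =
     (i.+2 * i.+1)%:R *: v i.+2 j
    - (if j is j'.+1 then (2 * (i.+1 + j') * i.+1)%:R *: v i.+1 j' else 0)
    + (if j is j'.+2 then ((i + j') * (i + j').+1)%:R *: v i j' else 0).
    by apply/rowP => t; rewrite !mxE Fex_side2; case: j {ij0} => [|[|j]]; rewrite !mxE.
  rewrite mulmxBl -scalemxAl hL //.
  case: j ij0 => [|j] ij0.
    by rewrite mul0mx !subr0 addr0 scalerA -natrM mulnC subrr.
  rewrite -scalemxAl.
  (* The formula for [K 1] fails at the origin, but there the coefficient [i + j] is zero. *)
  have [e|ij1] := posnP (i + j).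
    have [-> ->] : i = 0%N /\ j = 0%N by lia.
    by apply/rowP => t; rewrite !mxE; ring.
  rewrite hL //; apply/rowP => t; rewrite !mxE.
  by case: j {ij0 ij1} => [|j]; rewrite !mxE; ring.
have v10 := coefficient_vectors_vanish hk v00 hM hL.
(* Since [v 1 0 = 0], no composite with [psi] has a term in $x_2$, so $x_2$ itself is not
   attained. *)
have [g /(congr1 (fun f => f (mi2 1 0)))] := surj (psX k i2).
rewrite pscomp_mi2_10 => [|t]; last by have /rowP/(_ t) := v10; rewrite !mxE.
rewrite psX_delta.
have -> : mi2 1 0 == [ffun u => nat_of_bool (u == i2)].
  by apply/eqP/ffunP => s; rewrite !ffunE; case: (ord2P s) => ->.
by move/eqP; rewrite eq_sym oner_eq0.
Qed.
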